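(* Let $M$ be a residuated ordered monoid, or a near residuated ordered monoid such that $\bigvee M$ exists. Then $v(a)$ exists for any cyclic element $a$ of $M$ and is given by $$x^{v(a)}=\begin{cases} a/(a/x) & \text{if } x\in M_a^{LR}\\ \bigvee M & \text{otherwise}\end{cases}$$ for all $x\in M$.
   Context: An ordered monoid is a monoid $M$ with a partial order such that $x\le x'$ and $y\le y'$ imply $xy\le x'y'$. For $x,y\in M$, $x/y$ denotes the largest $z\in M$ with $zy\le x$, and $y\backslash x$ the largest $z\in M$ with $yz\le x$, when these exist. $M$ is residuated if $x/y$ and $y\backslash x$ exist for all $x,y\in M$. $M$ is near residuated if for all $x,y\in M$: whenever $zy\le x$ for some $z\in M$, $x/y$ exists, and whenever $yz\le x$ for some $z\in M$, $y\backslash x$ exists. An element $a\in M$ is cyclic if $xy\le a$ implies $yx\le a$ for all $x,y\in M$. $M_a^L$ (resp., $M_a^R$) is the set of all $x\in M$ for which $a/x$ (resp., $x\backslash a$) exists, and $M_a^{LR}=M_a^L\cap M_a^R$. A closure operation on a poset is an expansive, order-preserving, idempotent self-map; a nucleus on $M$ is a closure operation $\star$ with $x^\star y^\star\le(xy)^\star$ for all $x,y\in M$ (where $x^\star=\star(x)$). If there exists a coarsest (i.e. pointwise largest) nucleus $\star$ on $M$ such that $a^\star=a$, it is denoted $v(a)$. *)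

(* Defs.v *)
From HB Require Import structures.
From mathcomp Require Import all_boot all_order.
From mathcomp Require Import boolp classical_sets.

Set Implicit Arguments.
Unset Strict Implicit.
Unset Printing Implicit Defensive.

Local Open Scope classical_set_scope.
Local Open Scope group_scope.
Local Open Scope order_scope.

HB.mixin Record Monoid_POrder_isOrdered (d : Order.disp_t) M
    of Monoid M & Order.POrder d M := {
  le_mulg : forall x x' y y' : M, x <= x' -> y <= y' -> x * y <= x' * y'
}.

#[short(type="orderedMonoidType")]
HB.structure Definition OrderedMonoid (d : Order.disp_t) :=
  { M of Monoid M & Order.POrder d M & Monoid_POrder_isOrdered d M }.

Section OrderedMonoidDefs.
Context {d : Order.disp_t} {M : orderedMonoidType d}.
Implicit Types (x y z a : M) (A : set M) (nu : M -> M).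

Definition largest A z := A z /\ ubound A z.

(* The partial operations x / y and y \ x, as the set of their values: empty
   when the residual does not exist, the singleton of the residual otherwise. *)
Definition lresidual x y : set M := largest [set z | z * y <= x].
Definition rresidual y x : set M := largest [set z | y * z <= x].

Definition cyclic_elt a := forall x y, x * y <= a -> y * x <= a.

Definition ML a : set M := [set x | lresidual a x !=set0].
Definition MR a : set M := [set x | rresidual x a !=set0].
Definition MLR a : set M := ML a `&` MR a.

Definition closure_operation nu :=
  [/\ forall x, x <= nu x,
      {homo nu : x y / x <= y}
    & idempotent_fun nu].

Definition nucleus nu :=
  closure_operation nu /\ forall x y, nu x * nu y <= nu (x * y).

(* nu = v(a): pointwise largest among the nuclei fixing a. *)
Definition is_v a nu :=
  [/\ nucleus nu, nu a = a
    & forall mu : M -> M, nucleus mu -> mu a = a -> forall x, mu x <= nu x].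

End OrderedMonoidDefs.

Definition residuated (d : Order.disp_t) (M : orderedMonoidType d) :=
  forall x y : M, lresidual x y !=set0 /\ rresidual y x !=set0.

Definition near_residuated (d : Order.disp_t) (M : orderedMonoidType d) :=
  forall x y : M,
    ((exists z, z * y <= x) -> lresidual x y !=set0) /\
    ((exists z, y * z <= x) -> rresidual y x !=set0).

(* Main.v *)
(** For cyclic [a], the relation [z * x <= a] is symmetric in [x] and [z], and
    the double polar of [x], i.e. the largest [w] such that [w * z <= a] whenever
    [z * x <= a], defines the coarsest nucleus fixing [a] as soon as it exists
    for all [x].  If [a/x] exists, the double polar is [a/(a/x)]; otherwise, by
    near residuation, no [z] satisfies [z * x <= a], and it is the top element. *)

Require Import Defs.
From mathcomp Require Import all_boot all_order.
From mathcomp Require Import boolp classical_sets.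

Local Open Scope classical_set_scope.

Section DoublePolar.
Set Implicit Arguments.
Unset Strict Implicit.
Local Open Scope group_scope.
Local Open Scope order_scope.
Import Order.POrderTheory.
Context {d : Order.disp_t} {M : orderedMonoidType d}.
Implicit Types (x y z w a : M) (nu : M -> M).

Lemma residuated_near : residuated M -> near_residuated M.
Proof. by move=> res x y; have [] := res x y. Qed.

Lemma mulg_le x x' y a : x <= x' -> x' * y <= a -> x * y <= a.
Proof. by move=> le_x; apply: le_trans; exact: le_mulg. Qed.

Lemma le_lresidual a y w :
  lresidual a y w -> forall z, z <= w <-> z * y <= a.
Proof.
move=> [wya w_max] z; split; last exact: w_max.
by move=> le_zw; exact: mulg_le le_zw wya.
Qed.

(** The factor [z] changes sides, so that [x] lies in [double_polar a x] for every [x] exactly when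
    [a] is cyclic. *)
Definition double_polar a x := [set w | forall z, z * x <= a -> w * z <= a].

(** Among the conditions on [w], the one at the largest admissible [z], namely [y], implies all the
    others. *)
Lemma double_polar_lresidual a x y :
  lresidual a x y -> double_polar a x = [set w | w * y <= a].
Proof.
move=> y_res; apply/seteqP; split=> w /= w_pol.
  by apply: w_pol; apply/(le_lresidual y_res).
move=> z /(le_lresidual y_res) le_zy; apply: le_trans w_pol.
exact: le_mulg.
Qed.

Lemma double_polarT a x :
  ~ (exists z, z * x <= a) -> double_polar a x = [set: M].
Proof.
by move=> noz; apply/seteqP; split=> // w _ z zxa; case: noz; exists z.
Qed.

Lemma supremums_setT w : supremums [set: M] w <-> ubound [set: M] w.
Proof. by split=> [[]|w_ub] //; split=> // t; apply. Qed.

Section Cyclic.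
Variable a : M.
Hypothesis a_cyclic : cyclic_elt a.

Lemma MLR_cyclic x :
  near_residuated M -> MLR a x <-> exists z, z * x <= a.
Proof.
move=> near; split=> [[[z [zxa _]] _]|[z zxa]]; first by exists z.
by split; apply near; exists z => //; exact: a_cyclic.
Qed.

Lemma MLR_lresidual2 x :
  near_residuated M -> MLR a x ->
  exists2 y, lresidual a x y & lresidual a y !=set0.
Proof.
(* For the existence of a/y, the witness is [x] itself: [y * x <= a] gives [x * y <= a]. *)
move=> near [[y y_res] _]; exists y => //; apply near; exists x.
by apply: a_cyclic; case: y_res.
Qed.

(** The supremum of [M] serves only for [x] outside [MLR a], a case that does not arise when [M] is
    residuated. *)
Lemma largest_double_polar_ex x :
    residuated M \/ (near_residuated M /\ supremums [set: M] !=set0) ->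
  largest (double_polar a x) !=set0.
Proof.
move=> hM.
have near : near_residuated M by case: hM => [/residuated_near|[]].
have [xMLR|xNMLR] := pselect (MLR a x).
  have [y y_res [w w_res]] := MLR_lresidual2 near xMLR.
  by exists w; rewrite (double_polar_lresidual y_res).
case: hM => [res|[_ [w /supremums_setT w_ub]]].
  by case: xNMLR; split; have [] := res a x.
by exists w; rewrite double_polarT // => zP; exact/xNMLR/MLR_cyclic.
Qed.

Variable v : M -> M.
Hypothesis vP : forall x, largest (double_polar a x) (v x).

Let vM x z : z * x <= a -> v x * z <= a.
Proof. by case: (vP x) => + _; apply. Qed.

Let le_v x w : (forall z, z * x <= a -> w * z <= a) -> w <= v x.
Proof. by case: (vP x) => _; apply. Qed.

Lemma double_polar_nucleus : nucleus v.
Proof.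
have v_ext x : x <= v x by apply: le_v => z; exact: a_cyclic.
split; last first.
  (* [vM] moves the last factor to the front under [v]: from [z * x * y <= a] to [v y * z * x <= a],
     then to [v x * v y * z <= a]. *)
  move=> x y; apply: le_v => z; rewrite !mulgA => /vM.
  by rewrite mulgA => /vM; rewrite mulgA.
split=> //.
  move=> x y le_xy; apply: le_v => z zya; apply: vM.
  by apply: le_trans zya; exact: le_mulg.
move=> x /=; apply/le_anti/andP; split=> //.
(* [z * x <= a] implies [z * v x <= a], to which [vM] applies again. *)
by apply: le_v => z /vM/a_cyclic; exact: vM.
Qed.

(** Taking [z = 1] in the polar of [a] bounds [v a] by [a]. *)
Lemma double_polar_fix : v a = a.
Proof.
have [[v_ext _ _] _] := double_polar_nucleus.
apply/le_anti/andP; split=> //.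
by rewrite -[v a]mulg1; apply: vM; rewrite mul1g.
Qed.

(** If [x * z <= a], then [nu x * z <= nu x * nu z <= nu (x * z) <= nu a = a], so [nu x] lies in the
    double polar of [x]. *)
Lemma double_polar_coarsest nu :
  nucleus nu -> nu a = a -> forall x, nu x <= v x.
Proof.
move=> [[nu_ext nu_homo _] nuM] nu_a x; apply: le_v => z /a_cyclic xza.
rewrite -nu_a; apply: le_trans (nu_homo _ _ xza); apply: le_trans (nuM _ _).
exact: le_mulg.
Qed.

Lemma double_polar_is_v : is_v a v.
Proof.
split; [exact: double_polar_nucleus | exact: double_polar_fix |].
exact: double_polar_coarsest.
Qed.

End Cyclic.
End DoublePolar.

Theorem proposition8p10 (d : Order.disp_t) (M : orderedMonoidType d)
    (hM : residuated M \/ (near_residuated M /\ supremums [set: M] !=set0))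
    (a : M) (ha : cyclic_elt a) :
  exists v : M -> M,
    is_v a v /\
    forall x : M,
      (MLR a x -> exists2 y : M, lresidual a x y & lresidual a y (v x)) /\
      (~ MLR a x -> supremums [set: M] (v x)).
Proof.
have [v vP] := choice (fun x => largest_double_polar_ex ha x hM).
have near : near_residuated M by case: hM => [/residuated_near|[]].
exists v; split; first exact: double_polar_is_v vP.
move=> x; split=> [xMLR|xNMLR].
  have [y y_res _] := MLR_lresidual2 ha near xMLR.
  by exists y => //; rewrite /lresidual -(double_polar_lresidual y_res).
apply/supremums_setT; have [_] := vP x.
by rewrite double_polarT // => zP; exact/xNMLR/MLR_cyclic.
Qed.
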